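(* Let $(A,\cdot,[-,-])$ be a transposed Poisson algebra. Suppose that $(A,[-,-])$ is the sub-adjacent Lie algebra of an anti-pre-Lie algebra $(A,\circ)$. Then $(-\mathcal L_\cdot^*,-\mathcal L_\circ^*,A^* )$ is a representation of the transposed Poisson algebra $(A,\cdot,[-,-])$ if and only if $(A,\cdot,\circ)$ is an anti-pre-Lie Poisson algebra.
   Context: All vector spaces and algebras are finite-dimensional over an algebraically closed field $\mathbb K$ of characteristic zero. Transposed Poisson algebra $(A,\cdot,[-,-])$: $(A,\cdot)$ is a commutative associative algebra, $(A,[-,-])$ is a Lie algebra, and $2z\cdot[x,y]=[z\cdot x,y]+[x,z\cdot y]$ for all $x,y,z$. A representation $(\mu,\rho,V)$ of $(A,\cdot,[-,-])$: linear maps $\mu,\rho:A\to\mathrm{End}(V)$ with $\mu(x\cdot y)=\mu(x)\mu(y)$, $\rho([x,y])=\rho(x)\rho(y)-\rho(y)\rho(x)$, $2\mu(x)\rho(y)=\rho(x\cdot y)+\rho(y)\mu(x)$, and $2\mu([x,y])=\rho(x)\mu(y)-\rho(y)\mu(x)$ for all $x,y\in A$. Anti-pre-Lie algebra $(A,\circ)$: with $[x,y]=x\circ y-y\circ x$, one has $x\circ(y\circ z)-y\circ(x\circ z)=[y,x]\circ z$ and $[x,y]\circ z+[y,z]\circ x+[z,x]\circ y=0$. Then $(A,[-,-])$ is a Lie algebra, the sub-adjacent Lie algebra of $(A,\circ)$. Anti-pre-Lie Poisson algebra $(A,\cdot,\circ)$: $(A,\cdot)$ is commutative associative, $(A,\circ)$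 is anti-pre-Lie, and $2(x\circ y)\cdot z-2(y\circ x)\cdot z=y\cdot(x\circ z)-x\cdot(y\circ z)$, $2x\circ(y\cdot z)=(z\cdot x)\circ y+z\cdot(x\circ y)$ for all $x,y,z\in A$. $\mathcal L_\cdot(x)y=x\cdot y$, $\mathcal L_\circ(x)y=x\circ y$; for linear $\rho:A\to\mathrm{End}(V)$, $\rho^*:A\to\mathrm{End}(V^* )$ is given by $\langle\rho^*(x)u^*,v\rangle=-\langle u^*,\rho(x)v\rangle$. *)

(* Defs.v *)
From HB Require Import structures.
From mathcomp Require Import all_boot all_order all_algebra.

Set Implicit Arguments.
Unset Strict Implicit.
Unset Printing Implicit Defensive.

Import GRing.Theory.
Local Open Scope ring_scope.

(* A finite-dimensional algebra is a vectType A with a {bilinear A -> A -> A}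
   product; "2 w" is written w *+ 2. *)

Definition commutator (V : zmodType) (m : V -> V -> V) (x y : V) : V :=
  m x y - m y x.

Section Algebras.
Variables (K : fieldType) (A : vectType K).
Implicit Types dot br circ : {bilinear A -> A -> A}.

Record comm_assoc_algebra dot : Prop := CommAssocAlgebra {
  dot_comm : commutative dot;
  dot_assoc : associative dot
}.

Record lie_algebra br : Prop := LieAlgebra {
  lie_alt : forall x, br x x = 0;
  lie_jacobi : forall x y z,
    br x (br y z) + br y (br z x) + br z (br x y) = 0
}.

Record transposed_poisson_algebra dot br : Prop := TransposedPoissonAlgebra {
  tp_comm_assoc : comm_assoc_algebra dot;
  tp_lie : lie_algebra br;
  tp_compat : forall x y z,
    dot z (br x y) *+ 2 = br (dot z x) y + br x (dot z y)
}.

Record anti_pre_lie_algebra circ : Prop := AntiPreLieAlgebra {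
  apl_left : forall x y z,
    circ x (circ y z) - circ y (circ x z) = circ (commutator circ y x) z;
  apl_cyclic : forall x y z,
    circ (commutator circ x y) z + circ (commutator circ y z) x
      + circ (commutator circ z x) y = 0
}.

Definition sub_adjacent circ br : Prop := br =2 commutator circ.

Record anti_pre_lie_poisson_algebra dot circ : Prop :=
  AntiPreLiePoissonAlgebra {
  aplp_comm_assoc : comm_assoc_algebra dot;
  aplp_anti_pre_lie : anti_pre_lie_algebra circ;
  aplp_compat1 : forall x y z,
    dot (circ x y) z *+ 2 - dot (circ y x) z *+ 2
      = dot y (circ x z) - dot x (circ y z);
  aplp_compat2 : forall x y z,
    circ x (dot y z) *+ 2 = circ (dot z x) y + dot z (circ x y)
}.

Record representation dot br (V : vectType K) (mu rho : 'Hom(A, 'End(V))) :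
  Prop := Representation {
  rep_mul : forall x y, mu (dot x y) = (mu x \o mu y)%VF;
  rep_lie : forall x y, rho (br x y) = (rho x \o rho y)%VF - (rho y \o rho x)%VF;
  rep_compat1 : forall x y,
    (mu x \o rho y)%VF *+ 2 = rho (dot x y) + (rho y \o mu x)%VF;
  rep_compat2 : forall x y,
    mu (br x y) *+ 2 = (rho x \o mu y)%VF - (rho y \o mu x)%VF
}.

End Algebras.

Section LeftMultiplication.
Variables (K : fieldType) (A : vectType K) (m : {bilinear A -> A -> A}).

Definition left_mul_fun (x : A) : 'End(A) := linfun (m x).

Fact left_mul_fun_is_linear : linear left_mul_fun.
Proof.
by move=> k x y; apply/lfunP=> v; rewrite !lfun_simp /= linearPl.
Qed.
HB.instance Definition _ :=
  GRing.isLinear.Build K A 'End(A) *:%R left_mul_fun left_mul_fun_is_linear.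

Definition left_mul : 'Hom(A, 'End(A)) := linfun left_mul_fun.

Lemma left_mulE x y : left_mul x y = m x y.
Proof. by rewrite !lfunE. Qed.

End LeftMultiplication.

(* The dual space is 'Hom(V, K^o); dual_mapE is the pairing <rho^* (x) u, v>. *)
Section DualMap.
Variables (K : fieldType) (A V : vectType K) (rho : 'Hom(A, 'End(V))).
Local Notation dualV := 'Hom(V, K^o).

Definition dual_act (x : A) (u : dualV) : dualV := - (u \o rho x)%VF.

Fact dual_act_is_linear x : linear (dual_act x).
Proof.
by move=> k u v; rewrite /dual_act comp_lfunDl -comp_lfunZl opprD scalerN.
Qed.
HB.instance Definition _ x :=
  GRing.isLinear.Build K dualV dualV *:%R (dual_act x) (dual_act_is_linear x).

Definition dual_map_fun (x : A) : 'End(dualV) := linfun (dual_act x).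

Fact dual_map_fun_is_linear : linear dual_map_fun.
Proof.
move=> k x y; apply/lfunP=> u; rewrite !lfun_simp /= /dual_act.
by rewrite linearP comp_lfunDr -comp_lfunZr opprD scalerN.
Qed.
HB.instance Definition _ :=
  GRing.isLinear.Build K A 'End(dualV) *:%R dual_map_fun dual_map_fun_is_linear.

Definition dual_map : 'Hom(A, 'End(dualV)) := linfun dual_map_fun.

Lemma dual_mapE x (u : dualV) (v : V) : dual_map x u v = - u (rho x v).
Proof. by rewrite lfunE /= lfunE /= /dual_act opp_lfunE comp_lfunE. Qed.

End DualMap.

(* Main.v *)
Require Import Defs.
From HB Require Import structures.
From mathcomp Require Import all_boot all_order all_algebra.

Set Implicit Arguments.
Unset Strict Implicit.
Unset Printing Implicit Defensive.

Import GRing.Theory.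
Local Open Scope ring_scope.

(** Up to the two signs, [- L_m^*] is the plain transpose of [L_m]; transposition
    reverses composition. Since the dual separates points, each representation
    identity on [A^*] is therefore equivalent to the transposed identity on [A]:
    the first two become associativity and the left anti-pre-Lie identity, which
    hold by hypothesis, and the last two are the two compatibility conditions of
    an anti-pre-Lie Poisson algebra. *)

(** The coordinate functions of a basis are themselves linear forms, so two vectors on which all
    forms agree have the same coordinates. *)
Lemma dual_separates (K : fieldType) (V : vectType K) (v w : V) :
  (forall u : 'Hom(V, K^o), u v = u w) -> v = w.
Proof.
move=> eq_vw.
rewrite (coord_vbasis (memvf v)) (coord_vbasis (memvf w)).
apply: eq_bigr => i _; congr (_ *: _).
by have := eq_vw (linfun (coord (vbasis fullv) i : V -> K^o)); rewrite !lfunE.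
Qed.

Lemma opp_dual_left_mulE (K : fieldType) (A : vectType K)
    (m : {bilinear A -> A -> A}) x (u : 'Hom(A, K^o)) v :
  (- dual_map (left_mul m)) x u v = u (m x v).
Proof. by rewrite !opp_lfunE dual_mapE opprK left_mulE. Qed.

(** [f] and [g] are bare functions, so that sums and iterated products can be given pointwise. *)
Lemma dual_end_eqP (K : fieldType) (V : vectType K)
    (F G : 'End('Hom(V, K^o))) (f g : V -> V) :
  (forall u v, F u v = u (f v)) -> (forall u v, G u v = u (g v)) ->
  F = G <-> f =1 g.
Proof.
move=> FE GE; split=> [eqFG v | eqfg].
  by apply: dual_separates => u; rewrite -FE -GE eqFG.
by apply/lfunP=> u; apply/lfunP=> v; rewrite FE GE eqfg.
Qed.

(** Evaluating a composite at [u] and then [v] applies the left factor to [v] first, whence the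
    swapped [x] and [y] in the products on [A]. *)
Lemma transpose_representationP (K : fieldType) (A : vectType K)
    (dot br circ : {bilinear A -> A -> A})
    (mu rho : 'Hom(A, 'End('Hom(A, K^o)))) :
  (forall x u v, mu x u v = u (dot x v)) ->
  (forall x u v, rho x u v = u (circ x v)) ->
  representation dot br mu rho <->
  [/\ forall x y z, dot (dot x y) z = dot y (dot x z),
      forall x y z, circ (br x y) z = circ y (circ x z) - circ x (circ y z),
      forall x y z, circ y (dot x z) *+ 2 = circ (dot x y) z + dot x (circ y z) &
      forall x y z, dot (br x y) z *+ 2 = dot y (circ x z) - dot x (circ y z)].
Proof.
move=> muE rhoE.
pose evalE := (muE, rhoE, comp_lfunE, mulr2n, add_lfunE, opp_lfunE).
have mulP x y : mu (dot x y) = (mu x \o mu y)%VF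
    <-> dot (dot x y) =1 fun z => dot y (dot x z).
  by apply: dual_end_eqP => u v; rewrite !evalE.
have lieP x y : rho (br x y) = (rho x \o rho y)%VF - (rho y \o rho x)%VF
    <-> circ (br x y) =1 fun z => circ y (circ x z) - circ x (circ y z).
  by apply: dual_end_eqP => u v; rewrite !(raddfB u, evalE).
have compat1P x y :
    (mu x \o rho y)%VF *+ 2 = rho (dot x y) + (rho y \o mu x)%VF
    <-> (fun z => circ y (dot x z) *+ 2)
        =1 fun z => circ (dot x y) z + dot x (circ y z).
  by apply: dual_end_eqP => u v; rewrite !(raddfD u, evalE).
have compat2P x y :
    mu (br x y) *+ 2 = (rho x \o mu y)%VF - (rho y \o mu x)%VF
    <-> (fun z => dot (br x y) z *+ 2)
        =1 fun z => dot y (circ x z) - dot x (circ y z).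
  by apply: dual_end_eqP => u v; rewrite !(raddfB u, raddfD u, evalE).
split=> [[h1 h2 h3 h4] | [h1 h2 h3 h4]]; split=> x y.
- exact/mulP.
- exact/lieP.
- exact/compat1P.
- exact/compat2P.
- by apply/mulP/h1.
- by apply/lieP/h2.
- by apply/compat1P/h3.
- by apply/compat2P/h4.
Qed.

Theorem proposition3p8 (K : closedFieldType) (charK0 : [pchar K] =i pred0)
    (A : vectType K) (dot br circ : {bilinear A -> A -> A}) :
  transposed_poisson_algebra dot br ->
  anti_pre_lie_algebra circ ->
  sub_adjacent circ br ->
  representation dot br
    (- dual_map (left_mul dot)) (- dual_map (left_mul circ))
  <-> anti_pre_lie_poisson_algebra dot circ.
Proof.
move=> [[dotC dotA] _ _] aplA brE.
have dot_brE x y z :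
    dot (br x y) z *+ 2 = dot (circ x y) z *+ 2 - dot (circ y x) z *+ 2.
  by rewrite brE linearBl mulrnBl.
have repP := transpose_representationP br
  (opp_dual_left_mulE dot) (opp_dual_left_mulE circ).
split=> [/repP[_ _ compat1 compat2] | [_ _ compat1 compat2]].
  (* The numbering crosses: the second representation identity gives the first compatibility
     condition, and the first gives the second up to commutativity. *)
  split=> // x y z; first by rewrite -dot_brE compat2.
  by rewrite [dot y z]dotC compat1.
apply/repP; split=> x y z.
(* Commutativity absorbs the order reversal. *)
- by rewrite [dot x y]dotC dotA.
(* The reversed bracket in the anti-pre-Lie identity matches the order reversal exactly. *)
- by rewrite (apl_left aplA) brE.
- by rewrite [dot x z]dotC compat2.
- by rewrite dot_brE compat1.
Qed.
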